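(* Let $F_t(z)=z-tH(z)\in\mathbb E_t^{[\alpha]}\langle\langle z\rangle\rangle$ with inverse map $G_t(z)=z+tN_t(z)$, $N_t(z)=\sum_{m\ge1}t^{m-1}N_{[m]}(z)$, and let $\psi_k=[C_k(z)\frac{\partial}{\partial z}]$ for $k\ge1$. For any $m\ge1$, $$N_{[m]}(z)=\sum_{I\in\mathcal C_m}c_I\,\psi^Iz,$$ where, for any composition $I$, $$c_I=\sum_{J:\,I\succeq J}(-1)^{\ell(J)-1}\frac{fp(J)}{\pi_u(I,J)},$$ the sum being over all compositions $J$ such that $I$ is a refinement of $J$.
   Context: $K$ is a unital commutative $\mathbb Q$-algebra, $z=(z_1,\dots,z_n)$ are commutative or noncommutative free variables, and $t$ is a formal parameter commuting with $z$ and $K$. $K\langle\langle z\rangle\rangle$ and $K[[t]]\langle\langle z\rangle\rangle$ are the formal power series algebras in $z$ (in either the commutative or the noncommutative case); $o(\cdot)$ is the order in $z$. For $\alpha\ge1$, $\mathbb E_t^{[\alpha]}\langle\langle z\rangle\rangle$ is the set of automorphisms of $K[[t]]\langle\langle z\rangle\rangle$ over $K[[t]]$ of the form $F_t(z)=z-tH(z)$ with $H(z)\in K\langle\langle z\rangle\rangle^{\times n}$, $o(H(z))\ge\alpha$. Its inverse map $G_t=F_t^{-1}$ is written $G_t(z)=z+tN_t(z)$, and $N_{[m]}(z)\in K\langle\langle z\rangle\rangle^{\times n}$ ($m\ge1$) are defined by $N_t(z)=\sum_{m\ge1}t^{m-1}N_{[m]}(z)$. For a vector $\vec u=(u_1,\dots,u_n)$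 of power series, $[\vec u\frac{\partial}{\partial z}]$ is the derivation sending $z_i$ to $u_i$; operators are applied to vectors componentwise, so $Pz=(Pz_1,\dots,Pz_n)$. $C_m(z)\in K\langle\langle z\rangle\rangle^{\times n}$ are defined by $C_1(z)=H(z)$ and $C_m(z)=[C_{m-1}(z)\frac{\partial}{\partial z}]H(z)$ for $m\ge2$. A composition is a nonempty finite sequence $I=(i_1,\dots,i_k)$ of positive integers; $\ell(I)=k$, $|I|=i_1+\cdots+i_k$, $fp(I)=i_1$; $\mathcal C_m$ is the set of compositions with $|I|=m$; $\psi^I=\psi_{i_1}\cdots\psi_{i_k}$; $\pi_u(I)=\prod_{j=1}^k(i_1+\cdots+i_j)$. $J\succeq I$ means $J$ is a refinement of $I$: $J$ is the concatenation $J_1\cdot J_2\cdots J_k$ of compositions $J_a$ with $|J_a|=i_a$; then $\pi_u(J,I)=\prod_{a=1}^k\pi_u(J_a)$. *)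

(* Defs.v *)
From HB Require Import structures.
From mathcomp Require Import all_boot all_order all_algebra.
From mathcomp Require Import boolp mpoly.
From mathcomp Require Import zify.
Set Implicit Arguments.
Unset Strict Implicit.
Unset Printing Implicit Defensive.
Import GRing.Theory.
Local Open Scope ring_scope.

(* Graded monoid on [n] generators in which every element has finitely many
   factorizations, listed without repetition by [mfactor].  It plays the role
   of the monomials in z_1, ..., z_n, commuting or not. *)
Record monomials (n : nat) := Monomials {
  msort :> eqType;
  mone : msort;
  mmul : msort -> msort -> msort;
  mvar : 'I_n -> msort;
  mdegree : msort -> nat;
  mfactor : msort -> seq (msort * msort);
  mmul1l : left_id mone mmul;
  mmul1r : right_id mone mmul;
  mmulmA : associative mmul;
  mdegree1 : mdegree mone = 0%N;
  mdegreeX : forall i, mdegree (mvar i) = 1%N;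
  mdegreeM : {morph mdegree : u v / mmul u v >-> (u + v)%N};
  mfactor_uniq : forall w, uniq (mfactor w);
  mem_mfactor : forall w p, (p \in mfactor w) = (mmul p.1 p.2 == w) }.

Section FreeMonomials.
Variable n : nat.

Definition word_factor (w : seq 'I_n) :=
  [seq (take i w, drop i w) | i <- iota 0 (size w).+1].

Lemma word_factor_uniq w : uniq (word_factor w).
Proof.
rewrite map_inj_in_uniq ?iota_uniq // => i j.
rewrite !mem_iota !add0n !ltnS => /= hi hj [/(congr1 size)].
by rewrite !size_takel.
Qed.

Lemma mem_word_factor w p : (p \in word_factor w) = (p.1 ++ p.2 == w).
Proof.
apply/mapP/eqP => [[i _ ->] /=|<-]; first exact: cat_take_drop.
exists (size p.1); last by rewrite take_size_cat // drop_size_cat //; case: p.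
by rewrite mem_iota /= add0n ltnS size_cat leq_addr.
Qed.

Definition free_monomials : monomials n :=
  @Monomials n (seq 'I_n) [::] cat (fun i => [:: i]) size word_factor
    (@cat0s _) (@cats0 _) (@catA _) erefl (fun _ => erefl) (@size_cat _)
    word_factor_uniq mem_word_factor.

End FreeMonomials.

Section CommutativeMonomials.
Variable n : nat.

Definition mnm_factor (w : 'X_{1..n}) : seq ('X_{1..n} * 'X_{1..n}) :=
  [seq (bmnm u, (w - bmnm u)%MM)
     | u <- enum {: 'X_{1..n < (mdeg w).+1}} & (bmnm u <= w)%MM].

Lemma mnm_factor_uniq w : uniq (mnm_factor w).
Proof.
rewrite map_inj_in_uniq; first by rewrite filter_uniq ?enum_uniq.
by move=> u v _ _ [uv _]; apply: val_inj.
Qed.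

Lemma mem_mnm_factor w p : (p \in mnm_factor w) = ((p.1 + p.2)%MM == w).
Proof.
apply/mapP/eqP => [[u]|<-].
  by rewrite mem_filter => /andP[uw _] -> /=; rewrite addmC submK.
have lt_p : (mdeg p.1 < (mdeg (p.1 + p.2)).+1)%N.
  by rewrite mdegD ltnS leq_addr.
exists (BMultinom lt_p); last by rewrite /= addmC addmK; case: p lt_p.
by rewrite mem_filter mem_enum /= lem_addr.
Qed.

Lemma add0m_ : left_id (@mnm0 n) (@mnm_add n).
Proof. exact: add0m. Qed.

Lemma addm0_ : right_id (@mnm0 n) (@mnm_add n).
Proof. exact: addm0. Qed.

Lemma addmA_ : associative (@mnm_add n).
Proof. exact: addmA. Qed.

Definition comm_monomials : monomials n :=
  @Monomials n 'X_{1..n} (@mnm0 n) (@mnm_add n) (@mnm1 n) (@mdeg n) mnm_factor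
    add0m_ addm0_ addmA_ (@mdeg0 n) (@mdeg1 n) (@mdegD n)
    mnm_factor_uniq mem_mnm_factor.

End CommutativeMonomials.

Section NatMonomials.

Definition nat_factor (k : nat) := [seq (i, k - i)%N | i <- iota 0 k.+1].

Lemma nat_factor_uniq k : uniq (nat_factor k).
Proof. by rewrite map_inj_uniq ?iota_uniq // => i j []. Qed.

Lemma mem_nat_factor k p : (p \in nat_factor k) = (p.1 + p.2 == k)%N.
Proof.
apply/mapP/eqP => [[i]|<-].
  by rewrite mem_iota add0n ltnS => /= ik -> /=; rewrite subnKC.
exists p.1; last by rewrite addKn; case: p.
by rewrite mem_iota /= add0n ltnS leq_addr.
Qed.

(* The powers of the single parameter t. *)
Definition nat_monomials : monomials 1 :=
  @Monomials 1 nat 0%N addn (fun _ => 1%N) id nat_factor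
    add0n addn0 addnA erefl (fun _ => erefl) (fun _ _ => erefl)
    nat_factor_uniq mem_nat_factor.

End NatMonomials.

Definition z_monomials (commutative : bool) (n : nat) : monomials n :=
  if commutative then comm_monomials n else free_monomials n.

(* Formal power series; the coefficients commute with the variables. *)
Record fps (n : nat) (M : monomials n) (R : Type) :=
  Fps { fcoef : M -> R }.

Section FpsRing.
Variables (n : nat) (M : monomials n).

HB.instance Definition _ (R : Type) := gen_eqMixin (fps M R).
HB.instance Definition _ (R : Type) := gen_choiceMixin (fps M R).

Lemma fpsP (R : Type) (f g : fps M R) : fcoef f =1 fcoef g <-> f = g.
Proof.
split=> [|-> //]; case: f g => f [g] /= fg.
by congr Fps; apply/funext.
Qed.

Variable R : nzRingType.
Implicit Types f g h : fps M R.

Definition fps0 : fps M R := Fps (fun=> 0).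
Definition fps1 : fps M R := Fps (fun w => (w == mone M)%:R).
Definition fps_opp f : fps M R := Fps (fun w => - fcoef f w).
Definition fps_add f g : fps M R := Fps (fun w => fcoef f w + fcoef g w).
Definition fps_scale (a : R) f : fps M R := Fps (fun w => a * fcoef f w).
Definition fps_mul f g : fps M R :=
  Fps (fun w => \sum_(p <- mfactor w) fcoef f p.1 * fcoef g p.2).

Lemma fps_addA : associative fps_add.
Proof. by move=> f g h; apply/fpsP => w /=; rewrite addrA. Qed.

Lemma fps_addC : commutative fps_add.
Proof. by move=> f g; apply/fpsP => w /=; rewrite addrC. Qed.

Lemma fps_add0 : left_id fps0 fps_add.
Proof. by move=> f; apply/fpsP => w /=; rewrite add0r. Qed.

Lemma fps_addN : left_inverse fps0 fps_opp fps_add.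
Proof. by move=> f; apply/fpsP => w /=; rewrite addNr. Qed.

HB.instance Definition _ :=
  GRing.isZmodule.Build (fps M R) fps_addA fps_addC fps_add0 fps_addN.

Lemma fps_mulA : associative fps_mul.
Proof.
move=> f g h; apply/fpsP => w /=.
pose T (x : M * (M * M)) := fcoef f x.1 * (fcoef g x.2.1 * fcoef h x.2.2).
pose sl := [seq (p.1, q) | p <- mfactor w, q <- mfactor p.2].
pose sr := [seq (q.1, (q.2, p.2)) | p <- mfactor w, q <- mfactor p.1].
have memE x : (x \in sl) = (x \in sr).
  apply/allpairsPdep/allpairsPdep => -[p [q []]].
    rewrite !mem_mfactor => /eqP pw /eqP qp ->.
    exists (mmul p.1 q.1, q.2), (p.1, q.1).
    by rewrite !mem_mfactor /= -mmulmA qp pw !eqxx; case: (q).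
  rewrite !mem_mfactor => /eqP pw /eqP qp ->.
  exists (q.1, mmul q.2 p.2), (q.2, p.2).
  by rewrite !mem_mfactor /= mmulmA qp pw !eqxx.
have slr : perm_eq sl sr.
  apply: uniq_perm memE; apply: allpairs_uniq_dep => /=.
  - exact: mfactor_uniq.
  - by move=> p _; exact: mfactor_uniq.
  - move=> _ _ /allpairsPdep[p [q [+ + ->]]] /allpairsPdep[p' [q' [+ + ->]]].
    case: p p' q q' => [p1 p2] [p1' p2'] [q1 q2] [q1' q2'].
    rewrite !mem_mfactor /= => _ /eqP <- _ /eqP <- eq_pq.
    by case: eq_pq => -> -> ->.
  - exact: mfactor_uniq.
  - by move=> p _; exact: mfactor_uniq.
  - move=> _ _ /allpairsPdep[p [q [+ + ->]]] /allpairsPdep[p' [q' [+ + ->]]].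
    case: p p' q q' => [p1 p2] [p1' p2'] [q1 q2] [q1' q2'].
    rewrite !mem_mfactor /= => _ /eqP <- _ /eqP <- eq_pq.
    by case: eq_pq => -> -> ->.
transitivity (\sum_(x <- sl) T x).
  rewrite /sl big_allpairs_dep; apply: eq_bigr => p _.
  by rewrite mulr_sumr.
rewrite (perm_big _ slr) /sr big_allpairs_dep; apply: eq_bigr => p _.
by rewrite mulr_suml; apply: eq_bigr => q _; rewrite /T /= mulrA.
Qed.

Lemma fps_mul1l : left_id fps1 fps_mul.
Proof.
move=> f; apply/fpsP => w /=.
have w1 : (mone M, w) \in mfactor w by rewrite mem_mfactor /= mmul1l.
rewrite (bigD1_seq _ w1 (mfactor_uniq w)) /= eqxx mul1r.
rewrite big_seq_cond big1 ?addr0 // => -[a b] /andP[].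
rewrite mem_mfactor /= => /eqP <-; case: (a =P mone M) => [->|_ _].
  by rewrite mmul1l eqxx.
by rewrite mul0r.
Qed.

Lemma fps_mul1r : right_id fps1 fps_mul.
Proof.
move=> f; apply/fpsP => w /=.
have w1 : (w, mone M) \in mfactor w by rewrite mem_mfactor /= mmul1r.
rewrite (bigD1_seq _ w1 (mfactor_uniq w)) /= eqxx mulr1.
rewrite big_seq_cond big1 ?addr0 // => -[a b] /andP[].
rewrite mem_mfactor /= => /eqP <-; case: (b =P mone M) => [->|_ _].
  by rewrite mmul1r eqxx.
by rewrite mulr0.
Qed.

Lemma fps_mulDl : left_distributive fps_mul +%R.
Proof.
move=> f g h; apply/fpsP => w /=; rewrite -big_split /=.
by apply: eq_bigr => p _; rewrite mulrDl.
Qed.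

Lemma fps_mulDr : right_distributive fps_mul +%R.
Proof.
move=> f g h; apply/fpsP => w /=; rewrite -big_split /=.
by apply: eq_bigr => p _; rewrite mulrDr.
Qed.

Lemma fps1_neq0 : fps1 != 0 :> fps M R.
Proof.
apply/eqP => /fpsP/(_ (mone M))/eqP; rewrite /= eqxx.
by rewrite oner_eq0.
Qed.

HB.instance Definition _ :=
  GRing.Zmodule_isNzRing.Build (fps M R)
    fps_mulA fps_mul1l fps_mul1r fps_mulDl fps_mulDr fps1_neq0.

Lemma fps_scaleA a b f : fps_scale a (fps_scale b f) = fps_scale (a * b) f.
Proof. by apply/fpsP => w /=; rewrite mulrA. Qed.

Lemma fps_scale1 : left_id 1 fps_scale.
Proof. by move=> f; apply/fpsP => w /=; rewrite mul1r. Qed.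

Lemma fps_scaleDr : right_distributive fps_scale +%R.
Proof. by move=> a f g; apply/fpsP => w /=; rewrite mulrDr. Qed.

Lemma fps_scaleDl f : {morph fps_scale^~ f : a b / a + b}.
Proof. by move=> a b; apply/fpsP => w /=; rewrite mulrDl. Qed.

HB.instance Definition _ :=
  GRing.Zmodule_isLmodule.Build R (fps M R)
    fps_scaleA fps_scale1 fps_scaleDr fps_scaleDl.

Lemma fps_scaleAl (a : R) f g : a *: (f * g) = a *: f * g.
Proof.
apply/fpsP => w /=; rewrite mulr_sumr.
by apply: eq_bigr => p _; rewrite mulrA.
Qed.

HB.instance Definition _ :=
  GRing.Lmodule_isLalgebra.Build R (fps M R) fps_scaleAl.

(* the variable z_i *)
Definition fvar (i : 'I_n) : fps M R :=
  Fps (fun w => (w == mvar M i)%:R).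

(* o(f) >= a *)
Definition order_ge (a : nat) f :=
  forall w : M, (mdegree w < a)%N -> fcoef f w = 0.

(* [D] is the derivation [u d/dz]: the R-linear derivation sending z_i to
   u_i.  This determines D, also on series that are not polynomials, since a
   series of order >= d is a finite sum of monomials of degree d times
   series. *)
Definition is_derivation_along (u : 'I_n -> fps M R)
    (D : fps M R -> fps M R) :=
  [/\ linear D,
      forall f g, D (f * g) = D f * g + f * D g &
      forall i, D (fvar i) = u i].

End FpsRing.

Arguments fvar {n M R} i.

(* K[[t]] *)
Notation tfps K := (fps nat_monomials K).

(* K<<z>>, with commuting or free variables z_1, ..., z_n *)
Notation zfps commutative n K := (fps (z_monomials commutative n) K).

Section OverT.
Variables (n : nat) (M : monomials n) (K : nzRingType).

Definition tpar : tfps K := fvar ord0.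

(* the inclusion of K<<z>> in K[[t]]<<z>> *)
Definition tconst (f : fps M K) : fps M (tfps K) :=
  Fps (fun w => (fcoef f w)%:A).

(* the series f_k in K<<z>> such that f = \sum_k t^k f_k *)
Definition tcoef (k : nat) (f : fps M (tfps K)) : fps M K :=
  Fps (fun w => fcoef (fcoef f w) k).

End OverT.

Arguments tpar {K}.

Section Compositions.
Implicit Types (I J B : seq nat) (m : nat).

Definition is_composition I := (I != [::]) && (0%N \notin I).

(* all sequences of positive integers of sum m, for m <= fuel *)
Fixpoint compositions_rec (fuel m : nat) : seq (seq nat) :=
  match fuel, m with
  | _, 0 => [:: [::]]
  | 0, _ => [::]
  | fuel'.+1, _ =>
      [seq i :: J | i <- iota 1 m, J <- compositions_rec fuel' (m - i)%N]
  end.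

(* The set of compositions of m, for m >= 1. *)
Definition compositions m := compositions_rec m m.

Lemma compositions_recP fuel m I : (m <= fuel)%N ->
  (I \in compositions_rec fuel m) = (0%N \notin I) && (sumn I == m).
Proof.
elim: fuel m I => [|fuel IH] [|m] I // le_m.
- by case: I => [|[|a] L]; rewrite !inE ?addSn ?andbF.
- by case: I => [|[|a] L]; rewrite !inE ?addSn ?andbF.
apply/allpairsPdep/andP => [[i [J []]]|[]].
  rewrite mem_iota => im; rewrite IH; last by lia.
  move=> /andP[J0 /eqP sJ] ->; split; last by rewrite /= sJ; apply/eqP; lia.
  by rewrite inE negb_or J0 andbT; case: (i) im.
case: I => [|i J] //=; rewrite inE negb_or => /andP[i0 J0] /eqP sJ.
have i_in : i \in iota 1 m.+1 by rewrite mem_iota; lia.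
exists i, J; split=> //; rewrite IH; last by lia.
by rewrite J0; apply/eqP; lia.
Qed.

Lemma compositions_rec_uniq fuel m : uniq (compositions_rec fuel m).
Proof.
elim: fuel m => [|fuel IH] [|m] //.
apply: allpairs_uniq_dep.
- exact: iota_uniq.
- by move=> i _; exact: IH.
- by move=> [i I] [j J] _ _ /= [-> ->].
Qed.

Lemma mem_compositions m I : (0 < m)%N ->
  (I \in compositions m) = is_composition I && (sumn I == m).
Proof.
by move=> m0; rewrite compositions_recP // /is_composition; case: I m m0 => [|i I] [].
Qed.

Lemma compositions_uniq m : uniq (compositions m).
Proof. exact: compositions_rec_uniq. Qed.

(* length of the shortest prefix of I of sum j *)
Definition prefix_length I (j : nat) : nat :=
  find (fun k => sumn (take k I) == j) (iota 0 (size I).+1).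

(* Cuts I into consecutive blocks whose sums are the successive entries of J;
   meaningful only if I is a refinement of J, see [refinesP]. *)
Fixpoint blocks I J : seq (seq nat) :=
  if J is j :: J' then
    let k := prefix_length I j in take k I :: blocks (drop k I) J'
  else [::].

(* I is a refinement of J *)
Definition refines I J : bool :=
  [&& all is_composition (blocks I J), flatten (blocks I J) == I
    & map sumn (blocks I J) == J].

Lemma sumn_take_inj B k : 0%N \notin B -> (k <= size B)%N ->
  sumn (take k B) = sumn B -> k = size B.
Proof.
elim: B k => [|b B IH] [|k] //=; rewrite inE negb_or => /andP[b0 B0].
  by move=> _; lia.
by rewrite ltnS => kB /addnI /(IH _ B0 kB) ->.
Qed.

Lemma blocks_unique Bs I J : all is_composition Bs -> flatten Bs = I ->
  map sumn Bs = J -> blocks I J = Bs.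
Proof.
move=> + <- <-; elim: Bs => [|B Bs IH] //= /andP[/andP[_ B0] cBs].
set k := prefix_length _ _.
suff -> : k = size B by rewrite take_size_cat ?drop_size_cat ?IH.
set p : pred nat := fun i => sumn (take i (B ++ flatten Bs)) == sumn B.
have pB : p (size B) by rewrite /p take_size_cat.
have sB : (size B < (size (B ++ flatten Bs)).+1)%N.
  by rewrite ltnS size_cat leq_addr.
have le_k : (k <= size B)%N.
  rewrite leqNgt; apply/negP => /(before_find 0%N).
  by rewrite nth_iota // add0n; rewrite -/(p _) pB.
have has_p : has p (iota 0 (size (B ++ flatten Bs)).+1).
  by apply/hasP; exists (size B); rewrite // mem_iota add0n.
have := nth_find 0%N has_p; rewrite -/k nth_iota; last first.
  exact: leq_ltn_trans le_k sB.
rewrite add0n /p take_cat; case: ltngtP le_k => // lt_k _ /eqP eqs.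
exact: sumn_take_inj (ltnW lt_k) eqs.
Qed.

Lemma refinesP I J :
  reflect (exists Bs, [/\ all is_composition Bs, flatten Bs = I
                        & map sumn Bs = J])
          (refines I J).
Proof.
apply: (iffP and3P) => [[cB /eqP fB /eqP sB]|[Bs [cB fB sB]]].
  by exists (blocks I J).
by rewrite (blocks_unique cB fB sB) fB sB !eqxx.
Qed.

Definition pi_u I : nat := \prod_(j < size I) sumn (take j.+1 I).

(* pi_u(I, J), for I a refinement of J *)
Definition pi_u2 I J : nat := \prod_(B <- blocks I J) pi_u B.

Definition fp I : nat := head 0%N I.

(* A composition J which I refines has the same sum as I. *)
Definition inv_coef I : rat :=
  \sum_(J <- compositions (sumn I) | refines I J)
     (-1) ^+ (size J).-1 * (fp J)%:R / (pi_u2 I J)%:R.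

(* psi^I = psi_{i_1} o ... o psi_{i_k} *)
Definition comp_ops (A : Type) (psi : nat -> A -> A) I : A -> A :=
  foldr (fun i P => psi i \o P) id I.

End Compositions.

(* Main.v *)
Require Import Defs.
From HB Require Import structures.
From mathcomp Require Import all_boot all_order all_algebra.
From mathcomp Require Import boolp mpoly.
From mathcomp Require Import zify.
Set Implicit Arguments.
Unset Strict Implicit.
Unset Printing Implicit Defensive.
Import GRing.Theory.
Local Open Scope ring_scope.

(** The automorphism G, restricted to series without t, is a power series
    G = \sum_m t^m S_m of operators on K<<z>>, and N_[m] = S_m z; here S_m is
    [inverse_op m].  The proof compares two logarithmic derivatives of G with
    respect to t.

    On the right, D = G^-1 (dG/dt) is a derivation, because G is an algebra
    morphism and d/dt is a derivation.  Differentiating the identity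
    G(z - t H) = z gives D z = H + t D H, which is the recursion defining the
    C_m; as a derivation is determined by its values on the variables
    ([derivation_along_unique]), D = \sum_m t^(m-1) psi_m.  So
    m S_m = \sum_k S_(m-k) psi_k ([inverse_op_rec]), and unfolding this recursion
    expresses S_m as the sum of the psi^I / pi_u(I) ([complete_expansion]).

    On the left, let \sum_m t^(m-1) xi_m = (dG/dt) G^-1.  Solving
    m S_m = \sum_k xi_k S_(m-k) for xi_m gives the alternating sum of
    fp(J) S^J over the compositions J of m ([left_power_sum_rec]).
    Substituting the expansions of the S_j into S^J produces, for every
    refinement I of J, the term psi^I / pi_u(I, J); hence
    xi_m = \sum_I c_I psi^I ([left_power_sum_expansion]).

    Finally S_(m+1) z = S_m H, again because G(z - t H) = z.  Evaluating the
    recursion for xi on z at m + 1 and on H at m, the difference of the two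
    identities is S_(m+1) z = xi_(m+1) z ([left_power_sum_var]). *)

(** * Sums over compositions *)

(** Sorting the compositions by the sum k of all the entries but the last. *)
Lemma sum_compositions_rcons (V : nmodType) m (X : seq nat -> V) : (0 < m)%N ->
  \sum_(I <- compositions m) X I =
  \sum_(k < m) \sum_(I <- compositions k) X (rcons I (m - k)%N).
Proof.
move=> m_gt0.
pose r := [seq rcons J (m - k)%N | k <- iota 0 m, J <- compositions k].
have memr : compositions m =i r.
  move=> I; rewrite compositions_recP //; apply/andP/allpairsPdep.
    case: (lastP I) => [|J j]; first by move=> [_ /eqP/=]; lia.
    rewrite mem_rcons inE negb_or sumn_rcons => -[/andP[j0 J0] /eqP sJ].
    exists (sumn J), J; split; first by rewrite mem_iota; lia.
      by rewrite compositions_recP // J0 eqxx.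
    by congr rcons; lia.
  move=> [k [J []]]; rewrite mem_iota => km; rewrite compositions_recP //.
  move=> /andP[J0 /eqP sJ] ->; rewrite mem_rcons inE negb_or J0 sumn_rcons sJ.
  by split; [rewrite andbT|apply/eqP]; lia.
have uniqr : uniq r.
  apply: allpairs_uniq_dep; first exact: iota_uniq.
    by move=> k _; exact: compositions_uniq.
  move=> _ _ /allpairsPdep[k [I [_ + ->]]] /allpairsPdep[l [J [_ + ->]]] /=.
  rewrite !compositions_recP // => /andP[_ /eqP <-] /andP[_ /eqP <-].
  by move=> /rcons_inj[-> _].
rewrite (perm_big r) ?uniq_perm ?compositions_uniq //.
by rewrite /r big_allpairs_dep -{1}[m]subn0 -/(index_iota _ _) big_mkord.
Qed.

Lemma pi_u_rcons I k : pi_u (rcons I k) = (pi_u I * (sumn I + k))%N.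
Proof.
rewrite /pi_u size_rcons big_ord_recr /= -(size_rcons I k) take_size sumn_rcons.
congr (_ * _)%N; apply: eq_bigr => j _.
by rewrite -cats1 takel_cat.
Qed.

Lemma comp_ops_rcons A (psi : nat -> A -> A) I k f :
  comp_ops psi (rcons I k) f = comp_ops psi I (psi k f).
Proof. by elim: I => //= i I ->. Qed.

Lemma comp_ops_cat A (psi : nat -> A -> A) I J f :
  comp_ops psi (I ++ J) f = comp_ops psi I (comp_ops psi J f).
Proof. by elim: I => //= i I ->. Qed.

(** A refinement of [j :: J] is cut in a unique way into a composition of [j]
    and a refinement of [J], as entries are positive. *)
Lemma sum_refining_cons (V : nmodType) j J (X : seq nat -> V) :
  (0 < j)%N -> 0%N \notin J ->
  \sum_(I <- compositions (j + sumn J) | refines I (j :: J)) X I =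
  \sum_(B <- compositions j) \sum_(I <- compositions (sumn J) | refines I J)
     X (B ++ I).
Proof.
move=> j_gt0 J0.
pose r := [seq B ++ L | B <- compositions j,
                        L <- [seq L <- compositions (sumn J) | refines L J]].
have memr : [seq L <- compositions (j + sumn J) | refines L (j :: J)] =i r.
  move=> I; rewrite mem_filter compositions_recP //.
  apply/and3P/allpairsPdep => [[/refinesP[[|B Bs] [cB fB sB]] I0 sI]|] //.
    move: cB fB sB => /= /andP[/andP[B0 B0'] cB] fB [sB sBs].
    move: I0 sI; rewrite -fB mem_cat negb_or sumn_cat => /andP[_ Bs0] sI.
    exists B, (flatten Bs); split=> //.
      by rewrite compositions_recP // B0' sB eqxx.
    rewrite mem_filter compositions_recP // Bs0 /=; apply/andP; split.
      by apply/refinesP; exists Bs.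
    by move: sI; rewrite sB eqn_add2l.
  move=> [B [I' []]]; rewrite mem_filter !compositions_recP //.
  move=> /andP[B0 /eqP sB] /and3P[/refinesP[Bs [cB fB sBs]] I0 /eqP sI] ->.
  split; last by rewrite sumn_cat sB sI.
    apply/refinesP; exists (B :: Bs); split=> /=; rewrite ?fB ?sB ?sBs //.
    by rewrite cB andbT /is_composition B0 andbT; case: (B) sB => //=; lia.
  by rewrite mem_cat negb_or B0.
have uniqr : uniq r.
  apply: allpairs_uniq_dep; first exact: compositions_uniq.
    by move=> B _; rewrite filter_uniq ?compositions_uniq.
  move=> _ _ /allpairsPdep[B [I [+ _ ->]]] /allpairsPdep[B' [I' [+ _ ->]]] /=.
  rewrite !compositions_recP // => /andP[B0 /eqP sB] /andP[B'0 /eqP sB'] e.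
  suff sBB' : size B = size B'.
    by move/eqP: e; rewrite eqseq_cat // => /andP[/eqP -> /eqP ->].
  wlog le_B : B B' I I' B0 sB B'0 sB' e / (size B <= size B')%N.
    by case: (leqP (size B) (size B')) => [|/ltnW] h H;
      [|apply/esym]; apply: H; eauto.
  apply: (sumn_take_inj B'0 le_B); rewrite -[take _ _](takel_cat I') //.
  by rewrite -e take_size_cat // sB.
rewrite -big_filter (perm_big r) ?uniq_perm ?filter_uniq ?compositions_uniq //.
rewrite /r big_allpairs_dep; apply: eq_bigr => B _.
by rewrite big_filter.
Qed.

Lemma pi_u2_cat B I j J : is_composition B -> sumn B = j -> refines I J ->
  pi_u2 (B ++ I) (j :: J) = (pi_u B * pi_u2 I J)%N.
Proof.
move=> cB sB /refinesP[Bs [cBs fBs sBs]].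
rewrite /pi_u2 (blocks_unique cBs fBs sBs).
rewrite (@blocks_unique (B :: Bs)) ?big_cons //= ?cB ?fBs ?sB ?sBs //.
Qed.

(** * Operators defined by Newton recursions *)

Section Expansions.
Variables (K : comAlgType rat) (V : lmodType K).
Implicit Types (psi S : nat -> V -> V) (f : V).

Lemma natr_ratA m : m%:R = (m%:R : rat)%:A :> K.
Proof. by rewrite scaler_nat. Qed.

(** Each step of the recursion appends one last entry to the composition and
    divides by its sum, so that the denominators multiply to the product of
    all partial sums. *)
Lemma complete_expansion psi S : S 0%N =1 id ->
  (forall m f, m.+1%:R *: S m.+1 f =
    \sum_(k < m.+1) S k (psi (m.+1 - k)%N f)) ->
  forall m f, S m f =
    \sum_(I <- compositions m) ((pi_u I)%:R^-1 : rat)%:A *: comp_ops psi I f.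
Proof.
move=> S0 Srec; elim/ltn_ind => -[_ f|m IH f].
  by rewrite S0 /compositions /= big_seq1 /pi_u big_ord0 invr1 !scale1r.
rewrite sum_compositions_rcons //.
have m1 : (m.+1%:R : rat) != 0 by rewrite Num.Theory.pnatr_eq0.
have -> : S m.+1 f = (m.+1%:R^-1 : rat)%:A *: (m.+1%:R *: S m.+1 f).
  by rewrite scalerA natr_ratA mulr_algl scalerA mulVf // !scale1r.
rewrite Srec scaler_sumr; apply: eq_bigr => k _.
rewrite IH // scaler_sumr big_seq [RHS]big_seq; apply: eq_bigr => I.
rewrite compositions_recP // => /andP[_ /eqP sI].
rewrite comp_ops_rcons pi_u_rcons sI subnKC 1?ltnW // scalerA; congr (_ *: _).
by rewrite natrM invfM mulrC mulr_algl scalerA.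
Qed.

Definition first_weight (J : seq nat) : rat := (-1) ^+ (size J).-1 * (fp J)%:R.

(** The coefficient of t^(m-1) in S'(t) S(t)^-1, where S(t) is the generating
    series of the operators [S m]; see [left_power_sum_rec]. *)
Definition left_power_sum S m f : V :=
  \sum_(J <- compositions m) (first_weight J)%:A *: comp_ops S J f.

(** Appending an entry to a nonempty composition changes the sign of its
    weight and keeps its first entry: the compositions of length at least 2 in
    the first term cancel the second term, and the composition [:: m] alone
    remains. *)
Lemma left_power_sum_rec S m f : (0 < m)%N ->
  m%:R *: S m f = left_power_sum S m f +
    \sum_(1 <= k < m) left_power_sum S k (S (m - k)%N f).
Proof.
case: m => // m _; rewrite {1}/left_power_sum sum_compositions_rcons //.
rewrite big_ord_recl [compositions _]/= big_seq1 /= subn0 /first_weight /=.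
rewrite expr0 mul1r natr_ratA.
rewrite -addrA (big_addn 0 _ 1) subn1 big_mkord -big_split /=.
rewrite big1 ?addr0 // => k _.
rewrite /left_power_sum addn1 -big_split big_seq big1 //= => J.
rewrite compositions_recP // => /andP[_ /eqP sJ].
rewrite comp_ops_rcons -scalerDl -scalerDl size_rcons.
case: J sJ => //= j J _.
by rewrite /first_weight /= exprS mulN1r mulNr addNr !scale0r.
Qed.

(** Expanding every factor of S^J puts one composition in place of each entry
    of J, that is, a refinement of J with its cutting into blocks. *)
Lemma comp_ops_complete psi S :
  (forall k, (0 < k)%N -> linear (psi k)) ->
  (forall m f, S m f =
    \sum_(I <- compositions m) ((pi_u I)%:R^-1 : rat)%:A *: comp_ops psi I f) ->
  forall J f, 0%N \notin J -> comp_ops S J f =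
    \sum_(I <- compositions (sumn J) | refines I J)
       ((pi_u2 I J)%:R^-1 : rat)%:A *: comp_ops psi I f.
Proof.
move=> psiL SE; elim=> [|j J IH] f J0.
  rewrite /compositions /= big_cons big_nil /= addr0 /pi_u2 big_nil.
  by rewrite invr1 !scale1r.
move: J0; rewrite inE negb_or eq_sym -lt0n => /andP[j_gt0 J0].
rewrite sum_refining_cons //= SE big_seq [RHS]big_seq; apply: eq_bigr => B.
rewrite mem_compositions // => /andP[cB /eqP sB].
have opL : linear (comp_ops psi B).
  case/andP: cB => _; elim: B {sB} => //= b B IHB.
  rewrite inE negb_or eq_sym -lt0n.
  by case/andP => b0 /IHB L a u v; rewrite /= L psiL.
rewrite IH //.
have opS (s : seq (seq nat)) (P : pred (seq nat)) (a : seq nat -> K)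
    (u : seq nat -> V) :
    comp_ops psi B (\sum_(I <- s | P I) a I *: u I) =
    \sum_(I <- s | P I) a I *: comp_ops psi B (u I).
  apply: (big_rec2 (fun x y => comp_ops psi B x = y)) => [|I x y _ <-].
    by have := opL (- 1) 0 0; rewrite scaler0 addr0 scaleN1r addNr.
  exact: opL.
rewrite opS scaler_sumr; apply: eq_bigr => I rIJ.
rewrite comp_ops_cat (pi_u2_cat cB sB rIJ) scalerA.
by rewrite natrM invfM mulr_algl scalerA.
Qed.

Lemma left_power_sum_expansion psi S :
  (forall k, (0 < k)%N -> linear (psi k)) ->
  (forall m f, S m f =
    \sum_(I <- compositions m) ((pi_u I)%:R^-1 : rat)%:A *: comp_ops psi I f) ->
  forall m f, left_power_sum S m f =
    \sum_(I <- compositions m) (inv_coef I)%:A *: comp_ops psi I f.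
Proof.
move=> psiL SE m f; pose c J I := first_weight J / (pi_u2 I J)%:R.
transitivity (\sum_(J <- compositions m)
   \sum_(I <- compositions m | refines I J) (c J I)%:A *: comp_ops psi I f).
  rewrite /left_power_sum big_seq [RHS]big_seq; apply: eq_bigr => J.
  rewrite compositions_recP // => /andP[J0 /eqP sJ].
  rewrite (comp_ops_complete psiL SE) // sJ scaler_sumr; apply: eq_bigr => I _.
  by rewrite scalerA mulr_algl scalerA.
rewrite (exchange_big_dep predT) //= big_seq [RHS]big_seq; apply: eq_bigr => I.
rewrite compositions_recP // => /andP[I0 /eqP sI].
by rewrite /inv_coef sI scaler_suml scaler_suml.
Qed.
End Expansions.

(** * Variables determine derivations *)

Definition left_cancellative n (M : monomials n) :=
  forall i, injective (mmul (mvar M i)).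

Definition generated n (M : monomials n) :=
  forall w, w != mone M -> exists i v, w = mmul (mvar M i) v.

Lemma free_left_cancellative n : left_cancellative (free_monomials n).
Proof. by move=> i u v /= []. Qed.

Lemma comm_left_cancellative n : left_cancellative (comm_monomials n).
Proof.
move=> i u v /mnmP uv; apply/mnmP => j.
by have := uv j; rewrite !mnmDE => /addnI.
Qed.

Lemma free_generated n : generated (free_monomials n).
Proof. by case=> // i w _; exists i, w. Qed.

Lemma comm_generated n : generated (comm_monomials n).
Proof.
move=> w w0.
have [i wi] : exists i, (w : 'X_{1..n}) i != 0%N.
  apply/existsP; rewrite -[X in is_true X]negbK negb_exists; apply: contra w0.
  by move/forallP => w0; apply/eqP/mnmP => i; rewrite mnm0E; apply/eqP/negPn.
exists i, ((w : 'X_{1..n}) - U_(i))%MM.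
by apply/mnmP => j; rewrite mnmDE mnmBE mnm1E; case: eqP => [<-|_]; lia.
Qed.

Section VariableInduction.
Variables (n : nat) (M : monomials n) (R : nzRingType).
Hypotheses (Mcancel : left_cancellative M) (Mgen : generated M).
Implicit Types f g : fps M R.

Lemma fcoefM f g w :
  fcoef (f * g) w = \sum_(p <- mfactor w) fcoef f p.1 * fcoef g p.2.
Proof. by []. Qed.

Lemma fcoef_sum (I : Type) (r : seq I) (P : pred I) (E : I -> fps M R) w :
  fcoef (\sum_(i <- r | P i) E i) w = \sum_(i <- r | P i) fcoef (E i) w.
Proof. by apply: (big_rec2 (fun x y => fcoef x w = y)) => //= i x y _ <-. Qed.

Lemma fcoef_varM i g w :
  fcoef (fvar i * g) w = \sum_(p <- mfactor w | p.1 == mvar M i) fcoef g p.2.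
Proof.
rewrite fcoefM [RHS]big_mkcond; apply: eq_bigr => p _ /=.
by case: eqP => _; rewrite ?mul1r ?mul0r.
Qed.

Lemma order_varM d i g : order_ge d g -> order_ge d.+1 (fvar i * g).
Proof.
move=> gd w; rewrite ltnS => wd; rewrite fcoef_varM big_seq_cond big1 // => p.
rewrite mem_mfactor => /andP[/eqP pw /eqP p1]; apply: gd.
by move: wd; rewrite -pw p1 mdegreeM mdegreeX.
Qed.

(** With commuting variables a monomial may start with several variables;
    choosing one makes the decomposition of a series along them a function. *)
Definition first_var (w : M) : option 'I_n :=
  [pick i | mvar M i \in [seq p.1 | p <- mfactor w]].

Definition var_part i f : fps M R :=
  Fps (fun v => let w := mmul (mvar M i) v in
                if first_var w == Some i then fcoef f w else 0).

Lemma fcoef_var_part i f w :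
  fcoef (fvar i * var_part i f) w =
  if first_var w == Some i then fcoef f w else 0.
Proof.
rewrite fcoef_varM; case: ifPn => [|wi]; last first.
  rewrite big_seq_cond big1 // => p.
  rewrite mem_mfactor => /andP[/eqP pw /eqP p1].
  by rewrite /= -p1 pw (negPf wi).
move=> wi; have : mvar M i \in [seq p.1 | p <- mfactor w].
  by move: wi; rewrite /first_var; case: pickP => // j jw /eqP[<-].
move=> /mapP[p pw ip].
have pwE : mmul p.1 p.2 = w by apply/eqP; rewrite -mem_mfactor.
rewrite big_mkcond (bigD1_seq p) ?mfactor_uniq //= -ip eqxx ip pwE wi.
rewrite big_seq_cond big1 ?addr0 // => q /andP[qw qp]; case: eqP => // qi.
case/eqP: qp; move: qw qi; rewrite mem_mfactor => /eqP + qi.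
rewrite qi -pwE -ip.
by move/Mcancel; case: q p {pw pwE} ip qi => ? ? [? ?] /= <- -> ->.
Qed.

Lemma var_decomposition f :
  f = fcoef f (mone M) *: 1 + \sum_i fvar i * var_part i f.
Proof.
apply/fpsP => w /=; rewrite fcoef_sum.
under eq_bigr do rewrite fcoef_var_part.
case: (eqVneq w (mone M)) => [->|w1]; rewrite ?mulr1 ?mulr0 ?add0r.
  rewrite big1 ?addr0 // => i _; rewrite /first_var.
  case: pickP => // j /mapP[p]; rewrite mem_mfactor.
  move=> /eqP/(congr1 (@mdegree _ _)) + /(congr1 (@mdegree _ _)).
  by rewrite mdegreeM mdegree1 mdegreeX => + e; rewrite -e.
have [i wi] : exists i, first_var w = Some i.
  have [i [v wv]] := Mgen w1.
  rewrite /first_var; case: pickP => [j _|/(_ i)]; first by exists j.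
  move=> /mapP[]; exists (mvar M i, v) => //.
  by rewrite mem_mfactor wv.
rewrite (bigD1 i) //= wi eqxx big1 ?addr0 // => j ji.
by case: eqP => // -[ij]; rewrite ij eqxx in ji.
Qed.

(** Pulling out one variable at a time shows that [d f] has arbitrarily high
    order.  This reasoning covers series that are not polynomials without any
    continuity assumption on [d]. *)
Lemma linear_var_eq0 (d : fps M R -> fps M R) : linear d -> d 1 = 0 ->
  (forall i g, d (fvar i * g) = fvar i * d g) -> forall f, d f = 0.
Proof.
move=> dL d1 dX f.
suff d_order k : forall f, order_ge k (d f).
  by apply/fpsP => w; exact: (d_order (mdegree w).+1).
elim: k => [|k IH] {}f; first by [].
have d0 : d 0 = 0 by have := dL (- 1) 0 0; rewrite scaler0 addr0 scaleN1r addNr.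
have dD u v : d (u + v) = d u + d v by have := dL 1 u v; rewrite !scale1r.
rewrite [f]var_decomposition dL d1 scaler0 add0r (big_morph d dD d0) => w wk.
rewrite fcoef_sum big1 // => i _; rewrite dX.
exact: order_varM wk.
Qed.

End VariableInduction.

Lemma derivation_along_unique n (M : monomials n) (R : nzRingType)
    (u : 'I_n -> fps M R) (D D' : fps M R -> fps M R) :
  left_cancellative M -> generated M ->
  is_derivation_along u D -> is_derivation_along u D' -> D =1 D'.
Proof.
move=> Mc Mg [DL DM DX] [D'L D'M D'X] f.
apply/eqP; rewrite -subr_eq0; apply/eqP.
have D1 (E : fps M R -> fps M R) :
    (forall f g, E (f * g) = E f * g + f * E g) -> E 1 = 0.
  move=> EM; have := EM 1 1; rewrite !mulr1 mul1r => /eqP.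
  by rewrite -subr_eq0 opprD addrA subrr sub0r oppr_eq0 => /eqP.
apply: (linear_var_eq0 Mc Mg (d := fun f => D f - D' f)).
- by move=> a g h; rewrite DL D'L scalerBr opprD addrACA.
- by rewrite (D1 D DM) (D1 D' D'M) subrr.
- by move=> i g; rewrite DM D'M DX D'X opprD addrACA subrr add0r mulrBr.
Qed.

(** * Series in z over K[[t]] *)

Section TSeries.
Variables (n : nat) (M : monomials n) (R : nzRingType).
Implicit Types (f g : fps M (tfps R)) (a b : tfps R) (x y : fps M R).

Lemma tfpsM a b k :
  fcoef (a * b) k = \sum_(i < k.+1) fcoef a i * fcoef b (k - i)%N.
Proof.
rewrite fcoefM /= /nat_factor big_map.
by rewrite -[iota 0 k.+1]/(index_iota 0 k.+1) big_mkord.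
Qed.

Lemma tconstM x y : tconst (x * y) = tconst x * tconst y.
Proof.
apply/fpsP => w; rewrite [LHS]/= scaler_suml; apply: eq_bigr => p _ /=.
by rewrite mulr_algl scalerA.
Qed.

Lemma tcoef_mul_const k f x : tcoef k (f * tconst x) = tcoef k f * x.
Proof.
apply/fpsP => w; rewrite /= fcoef_sum; apply: eq_bigr => p _.
rewrite tfpsM big_ord_recr /= subnn !mulr1 big1 ?add0r // => i _.
by rewrite subn_eq0 leqNgt ltn_ord /= !mulr0.
Qed.

Lemma tcoef_const_mul k f x : tcoef k (tconst x * f) = x * tcoef k f.
Proof.
apply/fpsP => w; rewrite /= fcoef_sum; apply: eq_bigr => p _.
rewrite tfpsM big_ord_recl /= subn0 mulr1 big1 ?addr0 // => i _.
by rewrite mulr0 mul0r.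
Qed.

Lemma fcoef_tpar f w (k : nat) :
  fcoef (fcoef (tpar *: f) w) k =
  if k is k'.+1 then fcoef (fcoef f w) k' else 0.
Proof.
rewrite -[LHS]/(fcoef ((tpar : tfps R) * fcoef f w : tfps R) k) tfpsM.
case: k => [|k]; first by rewrite big_ord_recl big_ord0 /= mul0r addr0.
rewrite !big_ord_recl /= mul0r add0r mul1r subn1 big1 ?addr0 // => i _.
by rewrite mul0r.
Qed.

Definition tdiff a : tfps R :=
  Fps (fun k : nat_monomials => fcoef a k.+1 *+ k.+1).

Lemma tdiffD a b : tdiff (a + b) = tdiff a + tdiff b.
Proof. by apply/fpsP => k /=; rewrite mulrnDl. Qed.

(** The factor k + 1 in the coefficient of t^k is split as i + (k + 1 - i)
    along the product. *)
Lemma tdiffM a b : tdiff (a * b) = tdiff a * b + a * tdiff b.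
Proof.
apply/fpsP => k.
transitivity (fcoef (a * b) k.+1 *+ k.+1) => //.
transitivity (fcoef (tdiff a * b) k + fcoef (a * tdiff b) k) => //.
rewrite !tfpsM -sumrMnl.
transitivity (\sum_(i < k.+2) (fcoef a i * fcoef b (k.+1 - i)%N) *+ i
  + \sum_(i < k.+2) (fcoef a i * fcoef b (k.+1 - i)%N) *+ (k.+1 - i)).
  rewrite -big_split; apply: eq_bigr => i _ /=; rewrite -mulrnDr subnKC //.
  by rewrite -ltnS.
congr (_ + _).
  rewrite big_ord_recl mulr0n add0r; apply: eq_bigr => i _ /=.
  by rewrite mulrnAl.
rewrite big_ord_recr /= subnn mulr0n addr0; apply: eq_bigr => i _ /=.
by rewrite mulrnAr subSn // -ltnS.
Qed.

Definition tderiv f : fps M (tfps R) := Fps (fun w => tdiff (fcoef f w)).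

Lemma tderivM f g : tderiv (f * g) = tderiv f * g + f * tderiv g.
Proof.
apply/fpsP => w; rewrite [LHS]/= (big_morph tdiff tdiffD (id1 := 0)).
  by rewrite [RHS]/= -big_split; apply: eq_bigr => p _; rewrite tdiffM.
by apply/fpsP => k /=; rewrite mul0rn.
Qed.

Lemma tderivD f g : tderiv (f + g) = tderiv f + tderiv g.
Proof. by apply/fpsP => w; rewrite /= tdiffD. Qed.

Lemma tderiv_par f : tderiv (tpar *: f) = f + tpar *: tderiv f.
Proof.
apply/fpsP => w; apply/fpsP => k.
transitivity (fcoef (fcoef f w) k *+ k.+1).
  by rewrite -[LHS]/(fcoef (fcoef (tpar *: f) w) k.+1 *+ k.+1) fcoef_tpar.
transitivity (fcoef (fcoef f w) k + fcoef (fcoef (tpar *: tderiv f) w) k) => //.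
by rewrite fcoef_tpar mulrS; case: k.
Qed.

Lemma tderiv_const x : tderiv (tconst x) = 0.
Proof. by apply/fpsP => w; apply/fpsP => k /=; rewrite mulr0 mul0rn. Qed.

Lemma tcoef_const0 x : tcoef 0 (tconst x) = x.
Proof. by apply/fpsP => w; rewrite /= mulr1. Qed.

Lemma tcoef_constS k x : tcoef k.+1 (tconst x) = 0.
Proof. by apply/fpsP => w; rewrite /= mulr0. Qed.

Lemma tconst_var i : tconst (fvar i) = fvar i :> fps M (tfps R).
Proof. by apply/fpsP => w /=; case: eqP => _; rewrite ?scale1r ?scale0r. Qed.

Lemma tconst1 : tconst 1 = 1 :> fps M (tfps R).
Proof. by apply/fpsP => w /=; case: eqP => _; rewrite ?scale1r ?scale0r. Qed.

Lemma tconst_lin (a : R) x y :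
  tconst (a *: x + y) = a%:A *: tconst x + tconst y.
Proof.
by apply/fpsP => w; rewrite /= mulr_algl scalerA -scalerDl.
Qed.

Lemma fcoef_algZ (a : R) f w (k : nat) :
  fcoef (fcoef (a%:A *: f) w) k = a * fcoef (fcoef f w) k.
Proof.
by rewrite -[LHS]/(fcoef ((a%:A : tfps R) * fcoef f w : tfps R) k) mulr_algl.
Qed.

Lemma tcoef_lin k (a : R) f g :
  tcoef k (a%:A *: f + g) = a *: tcoef k f + tcoef k g.
Proof.
apply/fpsP => w.
transitivity (fcoef (fcoef (a%:A *: f) w) k + fcoef (fcoef g w) k) => //.
by rewrite fcoef_algZ.
Qed.

Lemma tcoef_par0 f : tcoef 0 (tpar *: f) = 0.
Proof. by apply/fpsP => w; exact: fcoef_tpar. Qed.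

Lemma tcoef_parS k f : tcoef k.+1 (tpar *: f) = tcoef k f.
Proof. by apply/fpsP => w; exact: fcoef_tpar. Qed.

Lemma tcoefD k f g : tcoef k (f + g) = tcoef k f + tcoef k g.
Proof. by []. Qed.

Lemma tcoef_deriv k f : tcoef k (tderiv f) = k.+1%:R *: tcoef k.+1 f.
Proof. by apply/fpsP => w /=; rewrite mulr_natl. Qed.

Lemma tderiv_lin (a : R) f g :
  tderiv (a%:A *: f + g) = a%:A *: tderiv f + tderiv g.
Proof.
rewrite tderivD; congr (_ + _); apply/fpsP => w; apply/fpsP => k.
transitivity (fcoef (fcoef (a%:A *: f) w) k.+1 *+ k.+1) => //.
by rewrite !fcoef_algZ /= mulrnAr.
Qed.

Definition tshift f : fps M (tfps R) :=
  Fps (fun w => Fps (fun k : nat_monomials => fcoef (fcoef f w) k.+1)).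

Lemma tshiftE f : f = tconst (tcoef 0 f) + tpar *: tshift f.
Proof.
apply/fpsP => w; apply/fpsP => -[|k].
  transitivity (fcoef (fcoef f w) 0 * 1 +
                fcoef (fcoef (tpar *: tshift f) w) 0) => //.
  by rewrite fcoef_tpar mulr1 addr0.
transitivity (fcoef (fcoef f w) 0 * 0 +
              fcoef (fcoef (tpar *: tshift f) w) k.+1) => //.
by rewrite fcoef_tpar mulr0 add0r.
Qed.

End TSeries.

(** * Logarithmic derivatives of the inverse automorphism *)

Section Inverse.
Variables (K : comAlgType rat) (n : nat) (M : monomials n).
Hypotheses (Mcancel : left_cancellative M) (Mgen : generated M).
Variables (H : 'I_n -> fps M K)
  (F G : {lrmorphism fps M (tfps K) -> fps M (tfps K)})
  (C : nat -> 'I_n -> fps M K) (psi : nat -> fps M K -> fps M K).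
Hypotheses (FX : forall i, F (fvar i) = fvar i - tpar *: tconst (H i))
  (FK : cancel F G) (GK : cancel G F)
  (C1 : forall i, C 1%N i = H i)
  (CS : forall m i, (2 <= m)%N -> C m i = psi m.-1 (H i))
  (psiC : forall k, (1 <= k)%N -> is_derivation_along (C k) (psi k)).

Definition inverse_op m (x : fps M K) := tcoef m (G (tconst x)).

(** The coefficients of G^-1 (dG/dt). *)
Definition dlog_op m (x : fps M K) := tcoef m (F (tderiv (G (tconst x)))).

Lemma G_var i : G (fvar i) = fvar i + tpar *: G (tconst (H i)).
Proof.
by have := FK (fvar i); rewrite FX linearB linearZ /= => {2}<-; rewrite subrK.
Qed.

Lemma inverse_op_var m i : inverse_op m.+1 (fvar i) = inverse_op m (H i).
Proof.
rewrite /inverse_op tconst_var G_var tcoefD tcoef_parS.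
by rewrite -tconst_var tcoef_constS add0r.
Qed.

(** G is the identity modulo t on the variables, hence everywhere. *)
Lemma inverse_op0 x : inverse_op 0 x = x.
Proof.
apply/eqP; rewrite -subr_eq0; apply/eqP.
apply: (linear_var_eq0 Mcancel Mgen (d := fun x => inverse_op 0 x - x)).
- move=> a u v; rewrite /inverse_op tconst_lin linearP tcoef_lin.
  by rewrite scalerBr opprD addrACA.
- by rewrite /inverse_op tconst1 rmorph1 -tconst1 tcoef_const0 subrr.
- move=> i g; rewrite mulrBr; congr (_ - _).
  rewrite /inverse_op tconstM rmorphM /= tconst_var G_var mulrDl -scalerAl.
  by rewrite tcoefD tcoef_par0 addr0 -tconst_var tcoef_const_mul.
Qed.

(** Applying F to the Leibniz rule for d/dt of (G u) (G v) turns the factors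
    without d/dt back into u and v. *)
Lemma dlog_op_derivation m :
  is_derivation_along (fun i => dlog_op m (fvar i)) (dlog_op m).
Proof.
split=> // [a u v|u v].
  by rewrite /dlog_op tconst_lin linearP tderiv_lin linearP tcoef_lin.
rewrite /dlog_op tconstM rmorphM /= tderivM rmorphD !rmorphM /= !GK tcoefD.
by rewrite tcoef_mul_const tcoef_const_mul.
Qed.

(** The equation D z = H + t D H for D = G^-1 (dG/dt), whose solution is given
    by the C_m. *)
Lemma FtderivG_var i : F (tderiv (G (fvar i))) =
  tconst (H i) + tpar *: F (tderiv (G (tconst (H i)))).
Proof.
rewrite G_var tderivD tderiv_par -tconst_var tderiv_const add0r.
by rewrite linearD linearZ /= GK.
Qed.

(** By induction on k, both sides are derivations along C_(k+1). *)
Lemma dlog_op_psi k : dlog_op k =1 psi k.+1.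
Proof.
elim: k => [|k IH];
  apply: (derivation_along_unique Mcancel Mgen _ (psiC _)) => //.
  case: (dlog_op_derivation 0) => TL TM _; split=> // i.
  rewrite /dlog_op tconst_var FtderivG_var tcoefD tcoef_par0 tcoef_const0.
  by rewrite addr0 C1.
case: (dlog_op_derivation k.+1) => TL TM _; split=> // i.
rewrite CS //= -IH /dlog_op tconst_var FtderivG_var tcoefD tcoef_parS.
by rewrite tcoef_constS add0r.
Qed.

(** As G is linear over K[[t]], it acts on series in t like the product with
    \sum_k t^k S_k; peeling off constant terms avoids infinite sums. *)
Lemma tcoef_inverse m f :
  tcoef m (G f) = \sum_(k < m.+1) inverse_op k (tcoef (m - k) f).
Proof.
elim: m f => [|m IH] f; rewrite {1}[f]tshiftE linearD linearZ /= tcoefD.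
  by rewrite tcoef_par0 addr0 big_ord1.
rewrite tcoef_parS IH [RHS]big_ord_recr /= subnn addrC; congr (_ + _).
by apply: eq_bigr => k _; rewrite subSn // -ltnS.
Qed.

(** The coefficient of t^m in dG/dt = G D. *)
Lemma inverse_op_rec m x :
  m.+1%:R *: inverse_op m.+1 x =
  \sum_(k < m.+1) inverse_op k (psi (m.+1 - k)%N x).
Proof.
rewrite /inverse_op -tcoef_deriv -[tderiv _]FK tcoef_inverse.
apply: eq_bigr => k _.
rewrite subSn -?dlog_op_psi //.
by rewrite -ltnS.
Qed.

(** By [inverse_op_var], the terms of [left_power_sum_rec] at m + 1 on z,
    except the first, are all the terms of [left_power_sum_rec] at m on H. *)
Lemma left_power_sum_var m i : (0 < m)%N ->
  left_power_sum inverse_op m (fvar i) = inverse_op m (fvar i).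
Proof.
case: m => // m _.
have := left_power_sum_rec inverse_op (fvar i) (ltn0Sn m).
suff -> : \sum_(1 <= k < m.+1)
    left_power_sum inverse_op k (inverse_op (m.+1 - k) (fvar i)) =
    m%:R *: inverse_op m (H i).
  by rewrite inverse_op_var -natr1 scalerDl scale1r addrC => /addIr.
case: m => [|m]; first by rewrite big_geq // scale0r.
rewrite left_power_sum_rec // big_nat_recr //= addrC; congr (_ + _).
  by rewrite subSnn inverse_op_var inverse_op0.
apply: eq_big_nat => k /andP[_ km].
by rewrite subSn ?inverse_op_var // ltnW.
Qed.

Lemma inverse_op_expansion m i : (0 < m)%N ->
  inverse_op m (fvar i) =
  \sum_(I <- compositions m) (inv_coef I)%:A *: comp_ops psi I (fvar i).
Proof.
move=> m_gt0; rewrite -left_power_sum_var //.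
have psiL k : (0 < k)%N -> linear (psi k) by move=> /psiC[].
apply: (left_power_sum_expansion psiL).
exact: complete_expansion inverse_op0 inverse_op_rec.
Qed.

End Inverse.

(** * The inverse map *)

Theorem proposition5p7 (K : comAlgType rat) (n : nat) (commutative : bool)
    (alpha : nat)
    (H : 'I_n -> zfps commutative n K)
    (F : {lrmorphism zfps commutative n (tfps K)
                  -> zfps commutative n (tfps K)})
    (G : zfps commutative n (tfps K)
         -> zfps commutative n (tfps K))
    (Nt : 'I_n -> zfps commutative n (tfps K))
    (N C : nat -> 'I_n -> zfps commutative n K)
    (psi : nat -> zfps commutative n K
           -> zfps commutative n K) :
  (1 <= alpha)%N ->
  (forall i, order_ge alpha (H i)) ->
  (forall i, F (fvar i) = fvar i - tpar *: tconst (H i)) ->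
  cancel F G -> cancel G F ->
  (forall i, G (fvar i) = fvar i + tpar *: Nt i) ->
  (forall m i, (1 <= m)%N -> N m i = tcoef m.-1 (Nt i)) ->
  (forall i, C 1%N i = H i) ->
  (forall m i, (2 <= m)%N -> C m i = psi m.-1 (H i)) ->
  (forall k, (1 <= k)%N -> is_derivation_along (C k) (psi k)) ->
  forall (m : nat) (i : 'I_n), (1 <= m)%N ->
  N m i = \sum_(I <- compositions m)
            (inv_coef I)%:A *: comp_ops psi I (fvar i).
Proof.
move=> _ _ FX FK GK GX NE C1 CS psiC m i m_gt0.
have GM : monoid_morphism G := can2_monoid_morphism FK GK.
have GL : linear G := can2_linear FK GK.
pose G' : {lrmorphism _ -> _} := HB.pack G
  (GRing.isMonoidMorphism.Build _ _ G GM) (GRing.isLinear.Build _ _ _ _ G GL).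
have cancelM : left_cancellative (z_monomials commutative n).
  by case: (commutative);
    [exact: comm_left_cancellative|exact: free_left_cancellative].
have genM : generated (z_monomials commutative n).
  by case: (commutative); [exact: comm_generated|exact: free_generated].
rewrite -(inverse_op_expansion cancelM genM (G := G') FX FK GK C1 CS psiC) //.
rewrite NE // /inverse_op tconst_var /= GX; case: m m_gt0 => // m _.
by rewrite tcoefD tcoef_parS -tconst_var tcoef_constS add0r.
Qed.
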